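(* Let $(-)^+$ be the semigroup (non-empty list) monad on $\mathbf{Set}$. Let $\Sigma^{\mathrm{s}}_+=\{\mathsf{a}:1,\ \cdot:2\}$ (a unary and a binary operation symbol) and let $E^{\mathrm{s}}_+$ contain the equations $$\mathsf{a}\mathsf{a}x=\mathsf{a}x,\qquad \mathsf{a}(x\cdot y)=x\cdot y,\qquad \mathsf{a}x\cdot\mathsf{a}y=x\cdot y,\qquad (x\cdot y)\cdot z=x\cdot(y\cdot z).$$ Then there is an isomorphism of categories $\mathbf{A}(\Sigma^{\mathrm{s}}_+,E^{\mathrm{s}}_+)\cong\mathrm{EM}_{\mathrm{s}}((-)^+)$.
   Context: The monad $(-)^+$ sends $X$ to the set $X^+$ of non-empty finite lists over $X$; the unit is $\eta_X(x)=[x]$ and the multiplication $\mu_X:(X^+)^+\to X^+$ is concatenation (flattening) of a non-empty list of non-empty lists. For a monad $(M,\eta,\mu)$, an $M$-semialgebra is a pair $(X,x)$ with $x:MX\to X$ satisfying $x\circ Mx=x\circ\mu_X$ (no unit axiom). A homomorphism $(X,x)\to(Y,y)$ is $h:X\to Y$ with $h\circ x=y\circ Mh$. $\mathrm{EM}_{\mathrm{s}}(M)$ is the resulting category. For an algebraic theory $(\Sigma,E)$ (a signature of finitary operation symbols, written $f:n$ for arity $n$, and a set of equations between $\Sigma$-terms), $\mathbf{A}(\Sigma,E)$ is the category of $(\Sigma,E)$-algebras (sets with an operation $A^n\to A$ for each $f:n\in\Sigma$ satisfying all the equations in $E$) and operation-preserving maps. Here $E^{\mathrm{s}}_+$ consists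 of exactly the four listed equations. *)

(* Defs.v *)
From mathcomp Require Import all_boot.
From Stdlib Require Import ProofIrrelevance.

Set Implicit Arguments.
Unset Strict Implicit.
Unset Printing Implicit Defensive.

Record category := Category {
  obj : Type;
  hom : obj -> obj -> Type;
  idm : forall A, hom A A;
  comp : forall A B C, hom B C -> hom A B -> hom A C;
  comp_idl : forall A B (f : hom A B), comp (idm B) f = f;
  comp_idr : forall A B (f : hom A B), comp f (idm A) = f;
  comp_assoc : forall A B C D (h : hom C D) (g : hom B C) (f : hom A B),
    comp h (comp g f) = comp (comp h g) f
}.
Arguments idm {c} A.
Arguments comp {c A B C} g f.

Record functor (C D : category) := Functor {
  fobj : obj C -> obj D;
  farr : forall A B : obj C, hom A B -> hom (fobj A) (fobj B);
  farr_id : forall A : obj C, farr (idm A) = idm (fobj A);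
  farr_comp : forall (A B E : obj C) (g : hom B E) (f : hom A B),
    farr (comp g f) = comp (farr g) (farr f)
}.
Arguments fobj {C D} f A : rename.
Arguments farr {C D} f {A B} m : rename.

Definition functor_id (C : category) : functor C C :=
  @Functor C C id (fun _ _ f => f) (fun _ => erefl) (fun _ _ _ _ _ => erefl).

Lemma functor_comp_id (C D E : category) (G : functor D E) (F : functor C D)
    (A : obj C) : farr G (farr F (idm A)) = idm (fobj G (fobj F A)).
Proof. by rewrite !farr_id. Qed.

Lemma functor_comp_comp (C D E : category) (G : functor D E) (F : functor C D)
    (A B X : obj C) (g : hom B X) (f : hom A B) :
  farr G (farr F (comp g f)) = comp (farr G (farr F g)) (farr G (farr F f)).
Proof. by rewrite !farr_comp. Qed.

Definition functor_comp (C D E : category) (G : functor D E) (F : functor C D) :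
    functor C E :=
  @Functor C E (fun A => fobj G (fobj F A)) (fun _ _ f => farr G (farr F f))
    (functor_comp_id G F) (functor_comp_comp G F).

(* Equality of functors is Leibniz equality, so this is isomorphism of
   categories in the strict sense, not equivalence. *)
Definition isomorphic_categories (C D : category) : Prop :=
  exists (F : functor C D) (G : functor D C),
    functor_comp G F = functor_id C /\ functor_comp F G = functor_id D.

(* The category of sets is rendered by types and Rocq functions. *)
Record monad := Monad {
  mobj :> Type -> Type;
  mmap : forall X Y : Type, (X -> Y) -> mobj X -> mobj Y;
  munit : forall X : Type, X -> mobj X;
  mmult : forall X : Type, mobj (mobj X) -> mobj X;
  mmap_id : forall X (t : mobj X), mmap id t = t;
  mmap_comp : forall X Y Z (g : Y -> Z) (f : X -> Y) (t : mobj X),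
    mmap (g \o f) t = mmap g (mmap f t);
  munit_nat : forall X Y (f : X -> Y) (x : X),
    mmap f (munit x) = munit (f x);
  mmult_nat : forall X Y (f : X -> Y) (t : mobj (mobj X)),
    mmap f (mmult t) = mmult (mmap (mmap f) t);
  mmult_unitl : forall X (t : mobj X), mmult (munit t) = t;
  mmult_unitr : forall X (t : mobj X), mmult (mmap (@munit X) t) = t;
  mmult_assoc : forall X (t : mobj (mobj (mobj X))),
    mmult (mmult t) = mmult (mmap (@mmult X) t)
}.
Arguments mmap m {X Y} f t.
Arguments munit m {X} x.
Arguments mmult m {X} t.

Record semialgebra (M : monad) := Semialgebra {
  scar : Type;
  sact : M scar -> scar;
  sact_mult : forall t : M (M scar), sact (mmap M sact t) = sact (mmult M t)
}.
Arguments sact {M} s t.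

Record semialgebra_hom (M : monad) (X Y : semialgebra M) := SemialgebraHom {
  shom_fun :> scar X -> scar Y;
  shom_act : forall t : M (scar X),
    shom_fun (sact X t) = sact Y (mmap M shom_fun t)
}.

Lemma semialgebra_hom_eq (M : monad) (X Y : semialgebra M)
    (f g : semialgebra_hom X Y) : shom_fun f = shom_fun g -> f = g.
Proof.
case: f g => [f fP] [g gP] /= fg; case: _ / fg gP => gP.
by rewrite (proof_irrelevance _ fP gP).
Qed.

Lemma semialgebra_id_act (M : monad) (X : semialgebra M) (t : M (scar X)) :
  id (sact X t) = sact X (mmap M id t).
Proof. by rewrite mmap_id. Qed.

Lemma semialgebra_comp_act (M : monad) (X Y Z : semialgebra M)
    (g : semialgebra_hom Y Z) (f : semialgebra_hom X Y) (t : M (scar X)) :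
  (g \o f) (sact X t) = sact Z (mmap M (g \o f) t).
Proof. by rewrite mmap_comp /= !shom_act. Qed.

Definition semialgebra_id (M : monad) (X : semialgebra M) :
    semialgebra_hom X X :=
  SemialgebraHom (@semialgebra_id_act M X).

Definition semialgebra_comp (M : monad) (X Y Z : semialgebra M)
    (g : semialgebra_hom Y Z) (f : semialgebra_hom X Y) : semialgebra_hom X Z :=
  SemialgebraHom (semialgebra_comp_act g f).

Lemma semialgebra_comp_idl (M : monad) (X Y : semialgebra M)
    (f : semialgebra_hom X Y) : semialgebra_comp (semialgebra_id Y) f = f.
Proof. exact: semialgebra_hom_eq. Qed.

Lemma semialgebra_comp_idr (M : monad) (X Y : semialgebra M)
    (f : semialgebra_hom X Y) : semialgebra_comp f (semialgebra_id X) = f.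
Proof. exact: semialgebra_hom_eq. Qed.

Lemma semialgebra_comp_assoc (M : monad) (X Y Z W : semialgebra M)
    (h : semialgebra_hom Z W) (g : semialgebra_hom Y Z)
    (f : semialgebra_hom X Y) :
  semialgebra_comp h (semialgebra_comp g f)
  = semialgebra_comp (semialgebra_comp h g) f.
Proof. exact: semialgebra_hom_eq. Qed.

Definition EMs (M : monad) : category :=
  @Category (semialgebra M) (@semialgebra_hom M)
    (@semialgebra_id M) (@semialgebra_comp M)
    (@semialgebra_comp_idl M) (@semialgebra_comp_idr M)
    (@semialgebra_comp_assoc M).

Record signature := Signature {
  symbol : Type;
  arity : symbol -> nat
}.
Arguments arity {s} f.

Inductive term (S : signature) :=
  | Var of nat
  | App (f : symbol S) of ('I_(arity f) -> term S).
Arguments Var {S} n.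
Arguments App {S} f args.

Definition equations (S : signature) := term S -> term S -> Prop.

Fixpoint eval (S : signature) (A : Type)
    (op : forall f : symbol S, ('I_(arity f) -> A) -> A)
    (v : nat -> A) (t : term S) : A :=
  match t with
  | Var n => v n
  | App f args => op f (fun i => eval op v (args i))
  end.

Record algebra (S : signature) (E : equations S) := Algebra {
  acar : Type;
  aop : forall f : symbol S, ('I_(arity f) -> acar) -> acar;
  aop_sat : forall s t : term S, E s t ->
    forall v : nat -> acar, eval aop v s = eval aop v t
}.
Arguments aop {S E} a f args.

Record algebra_hom (S : signature) (E : equations S) (A B : algebra E) :=
  AlgebraHom {
    ahom_fun :> acar A -> acar B;
    ahom_op : forall (f : symbol S) (args : 'I_(arity f) -> acar A),
      ahom_fun (aop A f args) = aop B f (ahom_fun \o args)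
  }.

Lemma algebra_hom_eq (S : signature) (E : equations S) (A B : algebra E)
    (f g : algebra_hom A B) : ahom_fun f = ahom_fun g -> f = g.
Proof.
case: f g => [f fP] [g gP] /= fg; case: _ / fg gP => gP.
by rewrite (proof_irrelevance _ fP gP).
Qed.

Lemma algebra_comp_op (S : signature) (E : equations S) (A B C : algebra E)
    (h : algebra_hom B C) (g : algebra_hom A B)
    (f : symbol S) (args : 'I_(arity f) -> acar A) :
  (h \o g) (aop A f args) = aop C f ((h \o g) \o args).
Proof. by rewrite /= !ahom_op. Qed.

Definition algebra_id (S : signature) (E : equations S) (A : algebra E) :
    algebra_hom A A :=
  @AlgebraHom S E A A id (fun _ _ => erefl).

Definition algebra_comp (S : signature) (E : equations S) (A B C : algebra E)
    (h : algebra_hom B C) (g : algebra_hom A B) : algebra_hom A C :=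
  AlgebraHom (algebra_comp_op h g).

Lemma algebra_comp_idl (S : signature) (E : equations S) (A B : algebra E)
    (f : algebra_hom A B) : algebra_comp (algebra_id B) f = f.
Proof. exact: algebra_hom_eq. Qed.

Lemma algebra_comp_idr (S : signature) (E : equations S) (A B : algebra E)
    (f : algebra_hom A B) : algebra_comp f (algebra_id A) = f.
Proof. exact: algebra_hom_eq. Qed.

Lemma algebra_comp_assoc (S : signature) (E : equations S)
    (A B C D : algebra E) (k : algebra_hom C D) (h : algebra_hom B C)
    (g : algebra_hom A B) :
  algebra_comp k (algebra_comp h g) = algebra_comp (algebra_comp k h) g.
Proof. exact: algebra_hom_eq. Qed.

Definition Alg (S : signature) (E : equations S) : category :=
  @Category (algebra E) (@algebra_hom S E)
    (@algebra_id S E) (@algebra_comp S E)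
    (@algebra_comp_idl S E) (@algebra_comp_idr S E) (@algebra_comp_assoc S E).

Definition nelist (X : Type) : Type := {s : seq X | ~~ nilp s}.

Lemma nelist_map_subproof (X Y : Type) (f : X -> Y) (s : nelist X) :
  ~~ nilp (map f (val s)).
Proof. by case: s => -[]. Qed.

Definition nelist_map (X Y : Type) (f : X -> Y) (s : nelist X) : nelist Y :=
  exist _ (map f (val s)) (nelist_map_subproof f s).

Definition nelist_unit (X : Type) (x : X) : nelist X :=
  exist _ [:: x] isT.

Lemma nelist_flatten_subproof (X : Type) (ss : nelist (nelist X)) :
  ~~ nilp (flatten (map val (val ss))).
Proof. by case: ss => -[//|[[//|x s] ?] ss] ?. Qed.

Definition nelist_flatten (X : Type) (ss : nelist (nelist X)) : nelist X :=
  exist _ (flatten (map val (val ss))) (nelist_flatten_subproof ss).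

Lemma nelist_map_id (X : Type) (s : nelist X) : nelist_map id s = s.
Proof. by apply: val_inj; rewrite /= map_id. Qed.

Lemma nelist_map_comp (X Y Z : Type) (g : Y -> Z) (f : X -> Y) (s : nelist X) :
  nelist_map (g \o f) s = nelist_map g (nelist_map f s).
Proof. by apply: val_inj; rewrite /= map_comp. Qed.

Lemma nelist_unit_nat (X Y : Type) (f : X -> Y) (x : X) :
  nelist_map f (nelist_unit x) = nelist_unit (f x).
Proof. exact: val_inj. Qed.

Lemma nelist_flatten_nat (X Y : Type) (f : X -> Y) (ss : nelist (nelist X)) :
  nelist_map f (nelist_flatten ss)
  = nelist_flatten (nelist_map (nelist_map f) ss).
Proof. by apply: val_inj; rewrite /= map_flatten -!map_comp. Qed.

Lemma nelist_flatten_unitl (X : Type) (s : nelist X) :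
  nelist_flatten (nelist_unit s) = s.
Proof. by apply: val_inj; rewrite /= cats0. Qed.

Lemma nelist_flatten_unitr (X : Type) (s : nelist X) :
  nelist_flatten (nelist_map (@nelist_unit X) s) = s.
Proof. by apply: val_inj; rewrite /= -map_comp; elim: (val s) => //= x t ->. Qed.

Lemma nelist_flatten_assoc (X : Type) (s : nelist (nelist (nelist X))) :
  nelist_flatten (nelist_flatten s)
  = nelist_flatten (nelist_map (@nelist_flatten X) s).
Proof.
apply: val_inj; rewrite /= -map_comp; elim: (val s) => //= u t <-.
by rewrite map_cat flatten_cat.
Qed.

Definition nelist_monad : monad :=
  Monad nelist_map_id nelist_map_comp nelist_unit_nat nelist_flatten_nat
    nelist_flatten_unitl nelist_flatten_unitr nelist_flatten_assoc.

Inductive plus_symbol := sym_a | sym_dot.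

Definition plus_sig : signature :=
  @Signature plus_symbol (fun f => match f with sym_a => 1 | sym_dot => 2 end).

Definition ta (t : term plus_sig) : term plus_sig :=
  @App plus_sig sym_a (fun=> t).

Definition tdot (s t : term plus_sig) : term plus_sig :=
  @App plus_sig sym_dot (fun i : 'I_2 => if i == ord0 then s else t).

Inductive plus_eqns : equations plus_sig :=
  | eq_aa : let x := Var 0 in
      plus_eqns (ta (ta x)) (ta x)
  | eq_adot : let x := Var 0 in let y := Var 1 in
      plus_eqns (ta (tdot x y)) (tdot x y)
  | eq_dota : let x := Var 0 in let y := Var 1 in
      plus_eqns (tdot (ta x) (ta y)) (tdot x y)
  | eq_dotA : let x := Var 0 in let y := Var 1 in let z := Var 2 in
      plus_eqns (tdot (tdot x y) z) (tdot x (tdot y z)).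

(* Main.v *)
From mathcomp Require Import all_boot.
From Stdlib Require Import ProofIrrelevance FunctionalExtensionality.
Require Import Defs.

Set Implicit Arguments.
Unset Strict Implicit.
Unset Printing Implicit Defensive.

(* A semialgebra structure [act] on [X] is determined by [a x = act [x]] and
   [x . y = act [x; y]]: applying the semialgebra law to [[x]; s] and to
   [[x]; [act s]] gives [act (x :: s) = x . act s].  Conversely, given [a] and
   the product, set [act [x] = a x] and [act (x :: s) = x . act s]; no case
   distinction on the length of the list is needed in the proof of the
   semialgebra law because [x . a y = x . y].  Both translations preserve
   carriers and underlying functions of homomorphisms, so strict equality of
   the composite functors with the identities reduces to equality of the
   structures on a fixed carrier. *)

(** * Functors commuting with a faithful functor to sets *)

(** By proof irrelevance [q] may be any proof; when the two fibres are convertible, take [erefl] and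
    the transport disappears. *)
Lemma eq_rect_fiber (I : Type) (U : I -> Type) (i j : I) (p : i = j)
    (q : U i = U j) (x : U i) :
  eq_rect i U x j p = eq_rect (U i) id x (U j) q.
Proof. by case: _ / p q => q; rewrite (proof_irrelevance _ q erefl). Qed.

(** Faithfulness lets the arrow condition be stated on elements, so no hom-set is transported. Once
    extensionality makes the object map the identity, all transports are along [erefl]. *)
Lemma concrete_functor_eq_id (C : category) (U : obj C -> Type)
    (u : forall A B : obj C, hom A B -> U A -> U B)
    (u_inj : forall A B (f g : hom A B), u A B f = u A B g -> f = g)
    (F : functor C C) (p : forall A, fobj F A = A) :
  (forall A B (f : hom A B) (x : U (fobj F A)),
    eq_rect _ U (u _ _ (farr F f) x) _ (p B)
    = u _ _ f (eq_rect _ U x _ (p A))) ->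
  F = functor_id C.
Proof.
case: F p => Fo Fa Fid Fcomp /= p Fu.
have Fo_id : Fo = id by apply: functional_extensionality.
subst Fo.
have pE : p = fun A => erefl A by exact: proof_irrelevance.
subst p.
have Fa_id : Fa = fun A B f => f.
  do 3![apply: functional_extensionality_dep => ?].
  by apply: u_inj; apply: functional_extensionality => x; exact: Fu.
subst Fa.
by congr Functor; apply: proof_irrelevance.
Qed.

Lemma semialgebra_eq (M : monad) (X : Type) (f g : M X -> X) fP gP :
  f = g -> @Semialgebra M X f fP = @Semialgebra M X g gP.
Proof. by move=> fg; subst g; rewrite (proof_irrelevance _ fP gP). Qed.

Lemma algebra_eq (S : signature) (E : equations S) (X : Type)
    (o1 o2 : forall f : symbol S, ('I_(arity f) -> X) -> X) P1 P2 :
  o1 = o2 -> @Algebra S E X o1 P1 = @Algebra S E X o2 P2.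
Proof. by move=> o12; subst o2; rewrite (proof_irrelevance _ P1 P2). Qed.

(** * Non-empty lists and operations of arity one and two *)

Definition necons (X : Type) (x : X) (s : seq X) : nelist X :=
  exist _ (x :: s) isT.

Lemma neconsP (X : Type) (P : nelist X -> Prop) :
  (forall x s, P (necons x s)) -> forall t, P t.
Proof.
by move=> Pcons [[|x s] p] //; rewrite (proof_irrelevance _ p isT); exact: Pcons.
Qed.

Lemma nelist_map_cons (X Y : Type) (f : X -> Y) (x : X) (s : seq X) :
  nelist_map f (necons x s) = necons (f x) (map f s).
Proof. exact: val_inj. Qed.

Definition pair2 (X : Type) (x y : X) : 'I_2 -> X :=
  fun i => if i == ord0 then x else y.

Lemma comp_pair2 (X Y : Type) (f : X -> Y) (x y : X) :
  f \o pair2 x y = pair2 (f x) (f y).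
Proof.
by apply: functional_extensionality => i; rewrite /= /pair2; case: ifP.
Qed.

Lemma pair2E (X : Type) (args : 'I_2 -> X) :
  pair2 (args ord0) (args ord_max) = args.
Proof.
apply: functional_extensionality => i; rewrite /pair2.
case: eqP => [-> //|]; case: i => -[|[|//]] lt2 i_neq0.
  by case: i_neq0; exact: val_inj.
by congr args; exact: val_inj.
Qed.

Lemma const1E (X : Type) (args : 'I_1 -> X) : (fun=> args ord0) = args.
Proof. by apply: functional_extensionality => i; rewrite ord1. Qed.

(** * From algebras to semialgebras *)

Definition alg_a (A : algebra plus_eqns) (x : acar A) : acar A :=
  aop A sym_a (fun=> x).

Definition alg_dot (A : algebra plus_eqns) (x y : acar A) : acar A :=
  aop A sym_dot (pair2 x y).

Lemma eval_tdot (X : Type)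
    (op : forall f : symbol plus_sig, ('I_(arity f) -> X) -> X) v s t :
  eval op v (tdot s t) = op sym_dot (pair2 (eval op v s) (eval op v t)).
Proof. by rewrite /=; congr op; exact: comp_pair2. Qed.

Lemma eval_ta (X : Type)
    (op : forall f : symbol plus_sig, ('I_(arity f) -> X) -> X) v t :
  eval op v (ta t) = op sym_a (fun=> eval op v t).
Proof. by []. Qed.

Section AlgebraLaws.
Variable A : algebra plus_eqns.
Implicit Types x y z : acar A.

Lemma alg_aa x : alg_a (alg_a x) = alg_a x.
Proof. exact: (aop_sat eq_aa (fun=> x)). Qed.

Lemma alg_adot x y : alg_a (alg_dot x y) = alg_dot x y.
Proof.
by have := aop_sat eq_adot (nth x [:: x; y]); rewrite eval_ta !eval_tdot.
Qed.

Lemma alg_dota x y : alg_dot (alg_a x) (alg_a y) = alg_dot x y.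
Proof.
by have := aop_sat eq_dota (nth x [:: x; y]); rewrite !eval_tdot.
Qed.

Lemma alg_dotA x y z : alg_dot (alg_dot x y) z = alg_dot x (alg_dot y z).
Proof.
by have := aop_sat eq_dotA (nth x [:: x; y; z]); rewrite !eval_tdot.
Qed.

(** Put [a] on both factors, collapse the doubled one by idempotence, then remove both. *)
Lemma alg_dotal x y : alg_dot (alg_a x) y = alg_dot x y.
Proof. by rewrite -alg_dota alg_aa alg_dota. Qed.

Lemma alg_dotar x y : alg_dot x (alg_a y) = alg_dot x y.
Proof. by rewrite -alg_dota alg_aa alg_dota. Qed.

(** Keeping the head apart makes the recursion structural on the tail, with no proof of
    non-emptiness to carry along. *)
Fixpoint alg_prod x (s : seq (acar A)) : acar A :=
  if s is y :: s' then alg_dot x (alg_prod y s') else alg_a x.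

Definition alg_act (t : nelist (acar A)) : acar A :=
  match t with exist s p =>
    match s return ~~ nilp s -> acar A with
    | [::] => fun p => False_rect _ (notF p)
    | x :: s' => fun=> alg_prod x s'
    end p
  end.

Lemma alg_a_prod x s : alg_a (alg_prod x s) = alg_prod x s.
Proof. by case: s => [|y s] /=; rewrite ?alg_aa ?alg_adot. Qed.

(** Induction on [s]: the base case absorbs the [a] left on [x], the inductive step is
    associativity. *)
Lemma alg_prod_cat x s y t :
  alg_prod x (s ++ y :: t) = alg_dot (alg_prod x s) (alg_prod y t).
Proof.
by elim: s x => [|z s IHs] x /=; rewrite ?alg_dotal // IHs alg_dotA.
Qed.

Lemma alg_act_mult (t : nelist (nelist (acar A))) :
  alg_act (nelist_map alg_act t) = alg_act (nelist_flatten t).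
Proof.
elim/neconsP: t => s ss; rewrite nelist_map_cons /=.
elim: ss s => [|s' ss IHss]; elim/neconsP => x s /=.
  (* A single inner list: the outer action only adds an [a], which fixes every product. *)
  by rewrite cats0 alg_a_prod.
rewrite IHss; elim/neconsP: s' => y s' /=.
by rewrite alg_prod_cat.
Qed.

Definition semi_of_alg : semialgebra nelist_monad :=
  @Semialgebra nelist_monad (acar A) alg_act alg_act_mult.

End AlgebraLaws.

Section AlgebraHom.
Variables (A B : algebra plus_eqns) (f : algebra_hom A B).

Lemma ahom_a x : f (alg_a x) = alg_a (f x).
Proof. exact: ahom_op. Qed.

Lemma ahom_dot x y : f (alg_dot x y) = alg_dot (f x) (f y).
Proof. by rewrite /alg_dot ahom_op comp_pair2. Qed.

Lemma ahom_act (t : nelist (acar A)) :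
  f (alg_act t) = alg_act (nelist_map f t).
Proof.
elim/neconsP: t => x s /=.
by elim: s x => [|y s IHs] x /=; rewrite ?ahom_a // ahom_dot IHs.
Qed.

Definition semi_hom_of_alg :
    semialgebra_hom (semi_of_alg A) (semi_of_alg B) :=
  @SemialgebraHom nelist_monad (semi_of_alg A) (semi_of_alg B) f ahom_act.

End AlgebraHom.

(** * From semialgebras to algebras *)

Section SemialgebraLaws.
Variable X : semialgebra nelist_monad.
Let act (t : nelist (scar X)) : scar X := sact X t.

Lemma sact_flatten s (ss : seq (nelist (scar X))) :
  act (necons (act s) (map act ss)) = act (nelist_flatten (necons s ss)).
Proof. by rewrite -nelist_map_cons; exact: sact_mult. Qed.

Lemma sact_act s : act (necons (act s) [::]) = act s.
Proof.
by rewrite (sact_flatten s [::]); congr act; apply: val_inj; rewrite /= cats0.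
Qed.

Lemma sact_cat s t :
  act (necons (act s) [:: act t]) = act (nelist_flatten (necons s [:: t])).
Proof. exact: (sact_flatten s [:: t]). Qed.

Lemma sact_actlr x y :
  act (necons (act (nelist_unit x)) [:: act (nelist_unit y)])
  = act (necons x [:: y]).
Proof. by rewrite sact_cat; congr sact; apply: val_inj. Qed.

(** The semialgebra law needs every entry to be a value of [act], and [y] need not be one.
    [sact_actlr] replaces [y] by [act [y]]; the extra [act] this puts on [act s] is removed by
    [sact_act]. *)
Lemma sact_actl s y :
  act (necons (act s) [:: y])
  = act (nelist_flatten (necons s [:: nelist_unit y])).
Proof. by rewrite -sact_actlr sact_act sact_cat. Qed.

Lemma sact_actr x t :
  act (necons x [:: act t])
  = act (nelist_flatten (necons (nelist_unit x) [:: t])).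
Proof. by rewrite -sact_actlr sact_act sact_cat. Qed.

Definition semi_op (f : symbol plus_sig) :
    ('I_(arity f) -> scar X) -> scar X :=
  match f with
  | sym_a => fun args => act (necons (args ord0) [::])
  | sym_dot => fun args => act (necons (args ord0) [:: args ord_max])
  end.

Lemma semi_op_sat (s t : term plus_sig) : plus_eqns s t ->
  forall v : nat -> scar X, eval semi_op v s = eval semi_op v t.
Proof.
case=> * /=.
(* The first two equations say that [act [-]] fixes the values of [act] on lists of length one and
   two. *)
- exact: sact_act.
- exact: sact_act.
- by rewrite sact_cat; congr act; apply: val_inj.
(* Both bracketings become [act] of the same three-entry list. *)
- by rewrite sact_actl sact_actr; congr act; apply: val_inj.
Qed.

Definition alg_of_semi : algebra plus_eqns :=
  @Algebra plus_sig plus_eqns (scar X) semi_op semi_op_sat.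

End SemialgebraLaws.

Section SemialgebraHom.
Variables (X Y : semialgebra nelist_monad) (h : semialgebra_hom X Y).

Lemma shom_op (f : symbol plus_sig) (args : 'I_(arity f) -> scar X) :
  h (semi_op args) = semi_op (h \o args).
Proof.
by case: f args => args; rewrite /= shom_act; congr sact; apply: val_inj.
Qed.

Definition alg_hom_of_semi :
    algebra_hom (alg_of_semi X) (alg_of_semi Y) :=
  @AlgebraHom plus_sig plus_eqns (alg_of_semi X) (alg_of_semi Y) h shom_op.

End SemialgebraHom.

(** * The isomorphism *)

Lemma semi_of_algK (A : algebra plus_eqns) : alg_of_semi (semi_of_alg A) = A.
Proof.
case: A => A op opP; apply: algebra_eq.
apply: functional_extensionality_dep => f.
apply: functional_extensionality => args.
case: f args => args; first exact: congr1 (const1E args).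
(* The recovered product of [x] and [y] is [x . a y]. *)
have := alg_dotar (A := Algebra opP) (args ord0) (args ord_max).
by rewrite {2}/alg_dot pair2E.
Qed.

Lemma alg_of_semiK (X : semialgebra nelist_monad) :
  semi_of_alg (alg_of_semi X) = X.
Proof.
case: X => T act actP; apply: semialgebra_eq.
apply: functional_extensionality; elim/neconsP => x s /=.
elim: s x => [//|y s IHs] x /=; rewrite IHs.
(* By induction the rebuilt action is [act [x; act (y :: s)]], which flattens to
   [act (x :: y :: s)]. *)
have := sact_actr (X := Semialgebra actP) x (necons y s).
by congr (_ = act _); apply: val_inj; rewrite /= cats0.
Qed.

(** The round trip returns the same carrier by computation, so [eq_rect_fiber] applies with
    [erefl]. *)
Lemma eq_rect_semi_of_algK (A : algebra plus_eqns) (x : acar A) :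
  eq_rect _ (@acar _ _) (x : acar (alg_of_semi (semi_of_alg A))) _
    (semi_of_algK A) = x.
Proof. exact: (eq_rect_fiber (semi_of_algK A) (erefl (acar A)) x). Qed.

Lemma eq_rect_alg_of_semiK (X : semialgebra nelist_monad) (x : scar X) :
  eq_rect _ (@scar _) (x : scar (semi_of_alg (alg_of_semi X))) _
    (alg_of_semiK X) = x.
Proof. exact: (eq_rect_fiber (alg_of_semiK X) (erefl (scar X)) x). Qed.

Lemma semi_hom_of_alg_id (A : algebra plus_eqns) :
  semi_hom_of_alg (algebra_id A) = semialgebra_id (semi_of_alg A).
Proof. exact: semialgebra_hom_eq. Qed.

Lemma semi_hom_of_alg_comp (A B C : algebra plus_eqns)
    (g : algebra_hom B C) (f : algebra_hom A B) :
  semi_hom_of_alg (algebra_comp g f)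
  = semialgebra_comp (semi_hom_of_alg g) (semi_hom_of_alg f).
Proof. exact: semialgebra_hom_eq. Qed.

Lemma alg_hom_of_semi_id (X : semialgebra nelist_monad) :
  alg_hom_of_semi (semialgebra_id X) = algebra_id (alg_of_semi X).
Proof. exact: algebra_hom_eq. Qed.

Lemma alg_hom_of_semi_comp (X Y Z : semialgebra nelist_monad)
    (g : semialgebra_hom Y Z) (f : semialgebra_hom X Y) :
  alg_hom_of_semi (semialgebra_comp g f)
  = algebra_comp (alg_hom_of_semi g) (alg_hom_of_semi f).
Proof. exact: algebra_hom_eq. Qed.

Definition semi_functor : functor (Alg plus_eqns) (EMs nelist_monad) :=
  @Functor (Alg plus_eqns) (EMs nelist_monad) semi_of_alg semi_hom_of_alg
    semi_hom_of_alg_id semi_hom_of_alg_comp.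

Definition alg_functor : functor (EMs nelist_monad) (Alg plus_eqns) :=
  @Functor (EMs nelist_monad) (Alg plus_eqns) alg_of_semi alg_hom_of_semi
    alg_hom_of_semi_id alg_hom_of_semi_comp.

Theorem theorem5p2 :
  isomorphic_categories (Alg plus_eqns) (EMs nelist_monad).
Proof.
exists semi_functor, alg_functor; split.
- apply: (@concrete_functor_eq_id (Alg plus_eqns) (@acar _ _)
    (fun A B f => ahom_fun f) (@algebra_hom_eq _ _)
    (functor_comp alg_functor semi_functor) semi_of_algK).
  move=> A B f x.
  (* The round trip keeps the underlying function, so both sides are [f x] once the transports are
     removed. *)
  exact: etrans (@eq_rect_semi_of_algK B (f x))
    (congr1 f (esym (@eq_rect_semi_of_algK A x))).
- apply: (@concrete_functor_eq_id (EMs nelist_monad) (@scar _)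
    (fun X Y h => shom_fun h) (@semialgebra_hom_eq _)
    (functor_comp semi_functor alg_functor) alg_of_semiK).
  move=> X Y h x.
  exact: etrans (@eq_rect_alg_of_semiK Y (h x))
    (congr1 h (esym (@eq_rect_alg_of_semiK X x))).
Qed.
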